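(* Let $A \in \mathbb{R}^{m \times n}$ be a nonzero entrywise nonnegative matrix. For $k \in \mathbb{N}$ (including $k=0$), let $\nu_+^{[k]}(A)$ be the optimal value of the following semidefinite programming problem: \[ \nu_+^{[k]}(A) = \max_{W\in\mathbb{R}^{m\times n}} \left\{ \langle A, W \rangle \; : \; \begin{bmatrix} I & -W\\ -W^{T} & I \end{bmatrix} \in \mathcal{C}^{[k]} \right\}, \] where $\mathcal{C}^{[k]}$ is the cone of real symmetric matrices $M$ of size $N=m+n$ such that the polynomial $\left(\sum_{i=1}^{N} x_i^2\right)^{k} \left(\sum_{1\leq i,j \leq N} M_{i,j} x_i^2 x_j^2\right)$ is a sum of squares. Then \[ \operatorname{rank}_+(A) \geq \left(\frac{\nu_+^{[k]}(A)}{\|A\|_F}\right)^2. \]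
   Context: The nonnegative rank $\operatorname{rank}_+(A)$ of an entrywise nonnegative matrix $A\in\mathbb{R}^{m\times n}$ is the smallest integer $r$ such that $A=UV$ with $U\in\mathbb{R}^{m\times r}$ and $V\in\mathbb{R}^{r\times n}$ both entrywise nonnegative. A polynomial in $\mathbb{R}[x_1,\dots,x_N]$ is a sum of squares if it is a finite sum of squares of polynomials in $\mathbb{R}[x_1,\dots,x_N]$. $\langle X,Y\rangle = \operatorname{trace}(X^{T}Y)$, and $\|A\|_F = \sqrt{\sum_{i,j} A_{i,j}^2}$. The optimal value of a maximization program means the supremum of the objective over the feasible set. *)

(* Defs.v *)
From mathcomp Require Import all_boot all_order all_algebra.
(* mpoly has to be imported before the mathcomp-analysis files: in the other
   order their notations clash. *)
From mathcomp Require Import mpoly.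
From mathcomp Require Import boolp classical_sets reals constructive_ereal ereal.

Set Implicit Arguments.
Unset Strict Implicit.
Unset Printing Implicit Defensive.

Import Order.TTheory GRing.Theory Num.Theory.
Local Open Scope ring_scope.
Local Open Scope classical_set_scope.

Definition nonneg_mx (R : numDomainType) (m n : nat) (A : 'M[R]_(m, n)) : Prop :=
  forall i j, 0 <= A i j.

Definition has_nonneg_fact (R : numDomainType) (m n : nat) (A : 'M[R]_(m, n))
    (r : nat) : Prop :=
  exists (U : 'M[R]_(m, r)) (V : 'M[R]_(r, n)),
    [/\ nonneg_mx U, nonneg_mx V & A = U *m V].

Lemma ex_nonneg_fact (R : numDomainType) (m n : nat) (A : 'M[R]_(m, n)) :
  nonneg_mx A -> exists r, `[< has_nonneg_fact A r >].
Proof.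
move=> A0; exists m; apply/asboolP; exists 1%:M, A; split => //.
- by move=> i j; rewrite mxE ler0n.
- by rewrite mul1mx.
Qed.

Definition nonneg_rank (R : numDomainType) (m n : nat) (A : 'M[R]_(m, n))
    (A0 : nonneg_mx A) : nat :=
  ex_minn (ex_nonneg_fact A0).

Definition mx_inner (R : nzRingType) (m n : nat) (X Y : 'M[R]_(m, n)) : R :=
  \tr (X^T *m Y).

Definition frobenius_norm (R : rcfType) (m n : nat) (A : 'M[R]_(m, n)) : R :=
  Num.sqrt (\sum_i \sum_j A i j ^+ 2).

Definition is_sos (R : nzRingType) (N : nat) (p : {mpoly R[N]}) : Prop :=
  exists s : seq {mpoly R[N]}, p = \sum_(q <- s) q ^+ 2.

Definition sos_cone (R : nzRingType) (N k : nat) : set 'M[R]_N :=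
  [set M | M^T = M /\
    is_sos ((\sum_(i < N) ('X_i : {mpoly R[N]}) ^+ 2) ^+ k *
            (\sum_(i < N) \sum_(j < N) M i j *: ('X_i ^+ 2 * 'X_j ^+ 2)))].

(* The supremum is taken in the extended reals, so that finiteness of the
   optimal value is not presupposed. *)
Definition nu_plus (R : realType) (m n k : nat) (A : 'M[R]_(m, n)) : \bar R :=
  ereal_sup [set (mx_inner A W)%:E | W in
    [set W : 'M[R]_(m, n) |
      sos_cone k (block_mx 1%:M (- W) (- W^T) 1%:M)]].

(* Main.v *)
(** Evaluating the sum of squares at [x_i = sqrt y_i] shows that a matrix in
    the cone is copositive. For the block matrix, copositivity tested on
    [(|v| u, |u| v)] gives [u^T W v <= |u| |v|] for nonnegative [u], [v]. If
    [A = U V] with nonnegative factors, [A] is the sum of [r] rank-one matrices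
    [u_l v_l^T], so that [<A, W> <= \sum_l |u_l| |v_l|]. By Cauchy-Schwarz this
    is at most [sqrt r] times the square root of [\sum_l |u_l v_l^T|_F^2], and
    the latter sum is at most [|A|_F^2] because the cross terms
    [<u_l v_l^T, u_p v_p^T>] are nonnegative. As [W = 0] is feasible, the
    optimal value is nonnegative and the bound can be squared. *)
Require Import Defs.
From mathcomp Require Import all_boot all_order all_algebra.
From mathcomp Require Import mpoly.
From mathcomp Require Import boolp classical_sets reals constructive_ereal ereal.
From mathcomp Require Import ring lra.

Set Implicit Arguments.
Unset Strict Implicit.
Unset Printing Implicit Defensive.

Import Order.TTheory GRing.Theory Num.Theory.
Local Open Scope ring_scope.

Lemma is_sos_sum (R : nzRingType) (N : nat) (I : Type) (s : seq I)
    (f : I -> {mpoly R[N]}) : is_sos (\sum_(i <- s) f i ^+ 2).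
Proof. by exists [seq f i | i <- s]; rewrite big_map. Qed.

Lemma is_sosM (R : comNzRingType) (N : nat) (p q : {mpoly R[N]}) :
  is_sos p -> is_sos q -> is_sos (p * q).
Proof.
move=> [s ->] [t ->]; exists [seq x * y | x <- s, y <- t].
rewrite big_allpairs_dep big_distrlr /=.
by apply: eq_bigr => x _; apply: eq_bigr => y _; rewrite exprMn.
Qed.

Lemma is_sosX (R : comNzRingType) (N k : nat) (p : {mpoly R[N]}) :
  is_sos p -> is_sos (p ^+ k).
Proof.
move=> sp; elim: k => [|k IHk]; last by rewrite exprS; apply: is_sosM.
by exists [:: 1]; rewrite big_seq1 expr0 expr1n.
Qed.

(** Off-diagonal terms vanish, so the quartic form is a sum of the squares [('X_i ^+ 2) ^+ 2]; the
    multiplier preserves this. It makes [W = 0] feasible. *)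
Lemma sos_cone1 (R : comNzRingType) (N k : nat) :
  @sos_cone R N k (1%:M : 'M[R]_N).
Proof.
split; first exact: trmx1.
apply: is_sosM; first by apply/is_sosX/is_sos_sum.
rewrite (eq_bigr (fun i => ('X_i ^+ 2) ^+ 2)) => [|i _].
  exact: is_sos_sum.
rewrite (bigD1 i) //= big1 => [|j ji].
  by rewrite mxE eqxx scale1r addr0.
by rewrite mxE eq_sym (negbTE ji) scale0r.
Qed.

Lemma is_sos_meval_ge0 (R : realDomainType) (N : nat) (p : {mpoly R[N]})
    (x : 'I_N -> R) : is_sos p -> 0 <= p.@[x].
Proof.
move=> [s ->]; rewrite raddf_sum /=; apply: sumr_ge0 => q _.
by rewrite rmorphXn /= sqr_ge0.
Qed.

Lemma sos_cone_copositive (R : rcfType) (N k : nat) (M : 'M[R]_N)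
    (y : 'cV[R]_N) :
  sos_cone k M -> nonneg_mx y -> 0 <= \sum_i \sum_j M i j * (y i 0 * y j 0).
Proof.
move=> [_ sosM] y0.
have := is_sos_meval_ge0 (fun i => Num.sqrt (y i 0)) sosM.
rewrite rmorphM rmorphXn /= !raddf_sum /=.
under eq_bigr => i _ do rewrite rmorphXn /= mevalXU sqr_sqrtr //.
under [X in _ * X]eq_bigr => i _.
  rewrite raddf_sum /=.
  under eq_bigr => j _ do
    rewrite mevalZ rmorphM !rmorphXn /= !mevalXU !sqr_sqrtr //.
  over.
(* The multiplier has become [(\sum_i y i 0) ^+ k], which cancels only when the sum is positive. A
   nonnegative [y] with zero sum vanishes. *)
have [s0|s_neq0] := eqVneq (\sum_i y i 0) 0.
  have y_eq0 i : y i 0 = 0.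
    by move/eqP: s0; rewrite psumr_eq0 // => /allP/(_ i (mem_index_enum _))/eqP.
  move=> _; rewrite big1 // => i _; rewrite big1 // => j _.
  by rewrite y_eq0 mul0r mulr0.
have s_gt0 : 0 < \sum_i y i 0 by rewrite lt0r s_neq0 sumr_ge0.
by rewrite pmulr_rge0 // exprn_gt0.
Qed.

(** This is copositivity tested on the stacked vector [col_mx u v]: the identity blocks give the
    squared norms, and the two off-diagonal blocks each give the same bilinear form, hence the
    factor 2. *)
Lemma sos_cone_block_ge0 (R : rcfType) (m n k : nat) (W : 'M[R]_(m, n))
    (u : 'cV[R]_m) (v : 'cV[R]_n) :
  sos_cone k (block_mx 1%:M (- W) (- W^T) 1%:M) -> nonneg_mx u -> nonneg_mx v ->
  2 * (\sum_i \sum_j W i j * (u i 0 * v j 0)) <=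
    \sum_i u i 0 ^+ 2 + \sum_j v j 0 ^+ 2.
Proof.
move=> cW u0 v0.
have y0 : nonneg_mx (col_mx u v).
  by move=> i j; rewrite mxE; case: (split i).
have := sos_cone_copositive cW y0.
have diag p (w : 'cV[R]_p) :
    \sum_i \sum_j (1%:M : 'M_p) i j * (w i 0 * w j 0) = \sum_i w i 0 ^+ 2.
  apply: eq_bigr => i _; rewrite (bigD1 i) //= big1 => [|j ji].
    by rewrite mxE eqxx mul1r addr0.
  by rewrite mxE eq_sym (negbTE ji) mul0r.
rewrite big_split_ord /=.
under eq_bigr => i _.
  rewrite big_split_ord /=.
  under eq_bigr => j _ do rewrite block_mxEul !col_mxEu.
  under [X in _ + X]eq_bigr => j _ do
    rewrite block_mxEur col_mxEu col_mxEd mxE mulNr.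
  rewrite sumrN; over.
under [X in _ + X]eq_bigr => i _.
  rewrite big_split_ord /=.
  under eq_bigr => j _ do
    rewrite block_mxEdl col_mxEu col_mxEd !mxE mulNr [_ * u _ _]mulrC.
  under [X in _ + X]eq_bigr => j _ do rewrite block_mxEdr !col_mxEd.
  rewrite sumrN; over.
rewrite !big_split /= !diag !sumrN [X in - X + _]exchange_big /=.
lra.
Qed.

Lemma sos_cone_block_le (R : rcfType) (m n k : nat) (W : 'M[R]_(m, n))
    (u : 'cV[R]_m) (v : 'cV[R]_n) :
  sos_cone k (block_mx 1%:M (- W) (- W^T) 1%:M) -> nonneg_mx u -> nonneg_mx v ->
  \sum_i \sum_j W i j * (u i 0 * v j 0) <=
    Num.sqrt (\sum_i u i 0 ^+ 2) * Num.sqrt (\sum_j v j 0 ^+ 2).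
Proof.
move=> cW u0 v0.
set a := \sum_i u i 0 ^+ 2; set b := \sum_j v j 0 ^+ 2.
set t := \sum_i _.
have a0 : 0 <= a by apply: sumr_ge0 => i _; apply: sqr_ge0.
have b0 : 0 <= b by apply: sumr_ge0 => i _; apply: sqr_ge0.
have eq0 p (w : 'cV[R]_p) i : \sum_i w i 0 ^+ 2 = 0 -> w i 0 = 0.
  move/eqP; rewrite psumr_eq0 => [/allP/(_ i (mem_index_enum _))|j _].
    by rewrite sqrf_eq0 => /eqP.
  exact: sqr_ge0.
(* The rescaling below divides by both norms, so zero vectors are treated apart; for them the
   bilinear form is 0. *)
have [az|a_neq0] := eqVneq a 0.
  rewrite /t big1 ?mulr_ge0 ?sqrtr_ge0 // => i _; rewrite big1 // => j _.
  by rewrite (eq0 _ u) // mul0r mulr0.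
have [bz|b_neq0] := eqVneq b 0.
  rewrite /t big1 ?mulr_ge0 ?sqrtr_ge0 // => i _; rewrite big1 // => j _.
  by rewrite (eq0 _ v) // !mulr0.
set x := Num.sqrt a; set y := Num.sqrt b.
have x_gt0 : 0 < x by rewrite sqrtr_gt0 lt0r a_neq0.
have y_gt0 : 0 < y by rewrite sqrtr_gt0 lt0r b_neq0.
have scale_ge0 p (w : 'cV[R]_p) c : 0 < c -> nonneg_mx w -> nonneg_mx (c *: w).
  by move=> c0 w0 i j; rewrite mxE mulr_ge0 // ltW.
(* Both rescaled vectors have norm [x * y], the balanced case of the arithmetic-geometric
   inequality, so a factor [2 * (x * y)] cancels. *)
have := sos_cone_block_ge0 cW (scale_ge0 _ _ _ y_gt0 u0) (scale_ge0 _ _ _ x_gt0 v0).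
have -> : \sum_i \sum_j W i j * ((y *: u) i 0 * (x *: v) j 0) = x * y * t.
  rewrite mulr_sumr; apply: eq_bigr => i _; rewrite mulr_sumr.
  by apply: eq_bigr => j _; rewrite !mxE; ring.
under eq_bigr => i _ do rewrite mxE exprMn.
under [X in _ + X]eq_bigr => i _ do rewrite mxE exprMn.
rewrite -!mulr_sumr -/a -/b -(sqr_sqrtr a0) -(sqr_sqrtr b0) -/x -/y.
have -> : y ^+ 2 * x ^+ 2 + x ^+ 2 * y ^+ 2 = 2 * (x * y * (x * y)) by ring.
by rewrite !ler_pM2l ?mulr_gt0.
Qed.

(** Cauchy-Schwarz against the all-ones vector: the double sum of [(c l - c p) ^+ 2] is twice the
    difference of the two sides. *)
Lemma sqr_sum_le (R : realDomainType) (r : nat) (c : 'I_r -> R) :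
  (\sum_l c l) ^+ 2 <= r%:R * \sum_l c l ^+ 2.
Proof.
have : 0 <= \sum_l \sum_p (c l - c p) ^+ 2.
  by apply: sumr_ge0 => l _; apply: sumr_ge0 => p _; apply: sqr_ge0.
under eq_bigr => l _.
  under eq_bigr => p _ do rewrite sqrrB.
  rewrite big_split sumrB /= sumr_const card_ord sumrMnl -mulr_sumr.
  over.
rewrite big_split sumrB /= sumr_const card_ord !sumrMnl -mulr_suml.
rewrite -expr2 mulr_natl; set q := _ *+ r; set s := (\sum_l _) ^+ 2; lra.
Qed.

Lemma sum_sqr_le (R : realDomainType) (r : nat) (c : 'I_r -> R) :
  (forall l, 0 <= c l) -> \sum_l c l ^+ 2 <= (\sum_l c l) ^+ 2.
Proof.
move=> c0; rewrite [leRHS]expr2 mulr_suml; apply: ler_sum => l _.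
rewrite expr2 ler_wpM2l // (bigD1 l) //= lerDl.
by apply: sumr_ge0.
Qed.

Lemma mx_innerE (R : comNzRingType) (m n : nat) (X Y : 'M[R]_(m, n)) :
  mx_inner X Y = \sum_i \sum_j X i j * Y i j.
Proof.
rewrite /mx_inner /mxtrace exchange_big; apply: eq_bigr => j _.
by rewrite mxE; apply: eq_bigr => i _; rewrite mxE.
Qed.

Lemma mx_inner_le_nonneg_fact (R : rcfType) (m n k r : nat)
    (A W : 'M[R]_(m, n)) :
  has_nonneg_fact A r -> sos_cone k (block_mx 1%:M (- W) (- W^T) 1%:M) ->
  mx_inner A W <= Num.sqrt r%:R * frobenius_norm A.
Proof.
move=> [U [V [U0 V0 AUV]]] cW.
(* [c l] is the Frobenius norm of the rank-one term built from column [l] of [U] and row [l] of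
   [V]. *)
pose c l := Num.sqrt (\sum_i U i l ^+ 2) * Num.sqrt (\sum_j V l j ^+ 2).
have c0 l : 0 <= c l by rewrite mulr_ge0 ?sqrtr_ge0.
have AWc : mx_inner A W <= \sum_l c l.
  have -> : mx_inner A W = \sum_l \sum_i \sum_j W i j * (U i l * V l j).
    rewrite mx_innerE [RHS]exchange_big; apply: eq_bigr => i _.
    rewrite [RHS]exchange_big; apply: eq_bigr => j _.
    by rewrite AUV mxE mulrC mulr_sumr.
  apply: ler_sum => l _.
  have u0 : nonneg_mx (col l U) by move=> i j; rewrite mxE.
  have v0 : nonneg_mx (row l V)^T by move=> i j; rewrite !mxE.
  have := sos_cone_block_le cW u0 v0.
  under eq_bigr => i _ do under eq_bigr => j _ do rewrite !mxE.
  under [X in Num.sqrt X * _]eq_bigr => i _ do rewrite mxE.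
  by under [X in _ * Num.sqrt X]eq_bigr => i _ do rewrite !mxE.
apply: (le_trans AWc).
(* Since [\sum_l c l] is nonnegative, it is the square root of its square, and it suffices to
   compare radicands. *)
rewrite /frobenius_norm -sqrtrM ?ler0n // -(ger0_norm (sumr_ge0 _ _)) //.
rewrite -sqrtr_sqr; apply: ler_wsqrtr.
apply: (le_trans (sqr_sum_le c)); rewrite ler_wpM2l ?ler0n //.
have -> : \sum_l c l ^+ 2 = \sum_i \sum_j \sum_l (U i l * V l j) ^+ 2.
  transitivity (\sum_l \sum_i \sum_j (U i l * V l j) ^+ 2).
    apply: eq_bigr => l _.
    rewrite exprMn !sqr_sqrtr ?sumr_ge0 // => [|i _|i _]; rewrite ?sqr_ge0 //.
    by rewrite big_distrlr /=; do 2!apply: eq_bigr => ? _; rewrite exprMn.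
  by rewrite exchange_big; apply: eq_bigr => i _; rewrite exchange_big.
(* The cross terms are dropped entry by entry: [A i j] is a sum of the nonnegative products
   [U i l * V l j]. *)
apply: ler_sum => i _; apply: ler_sum => j _.
by rewrite AUV mxE; apply: sum_sqr_le => l; rewrite mulr_ge0.
Qed.

Lemma nu_plus_ge0 (R : realType) (m n k : nat) (A : 'M[R]_(m, n)) :
  (0 <= nu_plus k A)%E.
Proof.
apply: ereal_sup_ubound; exists 0; last by rewrite /mx_inner mulmx0 mxtrace0.
by rewrite /= trmx0 !oppr0 -scalar_mx_block; apply: sos_cone1.
Qed.

Lemma frobenius_norm_gt0 (R : rcfType) (m n : nat) (A : 'M[R]_(m, n)) :
  A <> 0 -> 0 < frobenius_norm A.
Proof.
move=> A_neq0; rewrite lt0r sqrtr_ge0 andbT; apply/eqP => F0; apply: A_neq0.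
have row0 i : 0 <= \sum_j A i j ^+ 2 by apply: sumr_ge0 => j _; apply: sqr_ge0.
move/eqP: F0; rewrite sqrtr_eq0 => Sle0.
have /eqP : \sum_i \sum_j A i j ^+ 2 = 0.
  by apply: le_anti; rewrite Sle0 sumr_ge0.
rewrite psumr_eq0 // => /allP S0; apply/matrixP => i j; rewrite mxE.
have := S0 i (mem_index_enum _); rewrite /= psumr_eq0 => [/allP|p _].
  by move/(_ j (mem_index_enum _)); rewrite sqrf_eq0 => /eqP.
exact: sqr_ge0.
Qed.

Theorem theorem5 (R : realType) (m n : nat) (A : 'M[R]_(m, n))
    (A_nonneg : nonneg_mx A) (A_neq0 : A <> 0) (k : nat) :
  ((nonneg_rank A_nonneg)%:R%:E >=
     (nu_plus k A / (frobenius_norm A)%:E) ^+ 2)%E.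
Proof.
rewrite /nonneg_rank; case: ex_minnP => r /asboolP rA _.
have F_gt0 := frobenius_norm_gt0 A_neq0.
have : (nu_plus k A <= (Num.sqrt r%:R * frobenius_norm A)%:E)%E.
  apply: ge_ereal_sup => _ [W cW <-].
  by rewrite lee_fin; apply: mx_inner_le_nonneg_fact rA cW.
have := nu_plus_ge0 k A.
(* The lower bound excludes [-oo] and the upper bound excludes [+oo], so the optimal value is a real
   [x]. *)
case: (nu_plus k A) => [x||] //; rewrite !lee_fin => x0 xF.
(* The norm is nonzero, so the extended-real quotient is the real one. *)
rewrite inver gt_eqF // -EFinM -EFin_expe lee_fin.
have q_ge0 : 0 <= x / frobenius_norm A by rewrite divr_ge0 // ltW.
rewrite -[leRHS]sqr_sqrtr ?ler0n // ler_sqr ?nnegrE ?sqrtr_ge0 //.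
by rewrite ler_pdivrMr.
Qed.
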